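(* There exist $k\in\mathbb{N}$, a rule $\mathcal{R}$ of order $k$ and a graphon $W\in\mathcal{W}_0$ such that the trajectory $\Phi^{\cdot}W$ with respect to $\mathcal{R}$ stays in $\mathcal{W}_0$ and is periodic but is not a fixed point; that is, there is $P>0$ with $\Phi^{t+P}W=\Phi^tW$ for all $t\ge0$, while $\Phi^tW\neq W$ for some $t\geq 0$.
   Context: $(\Omega,\pi)$ is a fixed atomless probability space whose sigma-algebra is separable (there is a countable family $\mathcal{C}$ of measurable sets such that for every measurable $S$ and $\delta>0$ some $T\in\mathcal{C}$ has $\pi(S\ominus T)<\delta$). $\mathcal{W}$ is the Banach space of kernels: bounded measurable functions $W:\Omega^2\to\mathbb{R}$ with $W(x,y)=W(y,x)$ a.e., identified when equal a.e., with the $L^\infty$-norm $\|\cdot\|_\infty$. $\mathcal{W}_0\subset\mathcal{W}$ is the set of graphons: kernels with values in $[0,1]$ a.e. $\mathcal{H}_k$ is the set of all (simple, labelled) graphs on vertex set $[k]$. A rule of order $k$ is a matrix $\mathcal{R}\in[0,1]^{\mathcal{H}_k\times\mathcal{H}_k}$ with $\sum_{J}\mathcal{R}_{H,J}=1$ for every $H\in\mathcal{H}_k$. For $F\in\mathcal{H}_k$, distinct $a,b\in[k]$ and $W\in\mathcal{W}$ define $$(T_F^{a,b}W)(x,y)=\int\prod_{ij\in E(F)}W(x_i,x_j)\prod_{ij\notin E(F)}(1-W(x_i,x_j))\prod_{i\in[k]\setminus\{a,b\}}\pi(\mathrm{d}x_i),\quad x_a=x,\ x_b=y,$$ where $ij$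 ranges over unordered pairs of distinct elements of $[k]$. The velocity operator is $$\mathfrak{V}_{\mathcal{R}}W=\sum_{F,H\in\mathcal{H}_k}\mathcal{R}_{F,H}\sum_{1\le a\ne b\le k}T_F^{a,b}W\cdot\left(\mathbb{I}_{\{ab\in E(H)\setminus E(F)\}}-\mathbb{I}_{\{ab\in E(F)\setminus E(H)\}}\right),$$ the inner sum being over ordered pairs. For a graphon $W$, the trajectory $t\mapsto\Phi^tW$ is the unique solution of $\frac{\mathrm{d}}{\mathrm{d}t}\Phi^tW=\mathfrak{V}_{\mathcal{R}}\Phi^tW$, $\Phi^0W=W$ (derivative with respect to $\|\cdot\|_\infty$), which exists for all $t\ge0$ and stays in $\mathcal{W}_0$ for $t\ge 0$. *)

(* Defs.v *)
From HB Require Import structures.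
From mathcomp Require Import all_boot all_order all_algebra.
From mathcomp Require Import all_classical all_reals all_analysis.

Set Implicit Arguments.
Unset Strict Implicit.
Unset Printing Implicit Defensive.

Import Order.TTheory GRing.Theory Num.Theory.
Import numFieldNormedType.Exports.

Local Open Scope classical_set_scope.
Local Open Scope ring_scope.

Section ProbabilitySpace.
Context d (Omega : measurableType d) (R : realType) (pi : probability Omega R).

Definition atomless : Prop :=
  forall A : set Omega, measurable A -> (0 < pi A)%E ->
  exists B : set Omega,
    [/\ measurable B, B `<=` A, (0 < pi B)%E & (pi B < pi A)%E].

Definition separable_sigma_algebra : Prop :=
  exists C : set (set Omega),
    [/\ countable C, C `<=` measurable &
        forall (S : set Omega) (delta : R), measurable S -> 0 < delta ->
        exists2 T : set Omega, C T & (pi (S `+` T) < delta%:E)%E].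

(* Elements of the space of kernels are handled through representatives:
   equality of kernels is always equality almost everywhere. *)
Definition kernel_fun (W : Omega * Omega -> R) : Prop :=
  [/\ measurable_fun setT W, bounded_fun W &
      {ae (pi \x pi)%E, forall z, W z = W (z.2, z.1)}].

Definition graphon (W : Omega * Omega -> R) : Prop :=
  kernel_fun W /\ {ae (pi \x pi)%E, forall z, 0 <= W z <= 1}.

End ProbabilitySpace.

(* A simple labelled graph on 'I_k is its set of edges, each a 2-subset. *)
Record graph (k : nat) := Graph {
  edges : {set {set 'I_k}};
  _ : [forall e in edges, #|e| == 2%N] }.

HB.instance Definition _ (k : nat) := [isSub for @edges k].
HB.instance Definition _ (k : nat) := [Finite of graph k by <:].

Definition is_rule (R : realType) (k : nat) (Q : graph k -> graph k -> R) :
    Prop :=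
  (forall F H, 0 <= Q F H <= 1) /\ (forall F, \sum_(H : graph k) Q F H = 1).

Section Velocity.
Context d (Omega : measurableType d) (R : realType) (pi : probability Omega R).
Context (k : nat).
Implicit Types (F H : graph k) (W : Omega * Omega -> R) (u : 'I_k -> Omega).

(* Unordered pairs are enumerated as i < j; as W is only symmetric a.e., another
   choice of orientation changes [T_op] on a null set only. *)
Definition density F W u : R :=
  (\prod_(i < k) \prod_(j < k | (i < j)%N && ([set i; j]%SET \in edges F))
     W (u i, u j)) *
  (\prod_(i < k) \prod_(j < k | (i < j)%N && ([set i; j]%SET \notin edges F))
     (1 - W (u i, u j))).

(* Integrates f against pi in each of the coordinates listed in s, the remaining
   coordinates being those of u. For bounded measurable f and duplicate-free s
   this is, by Fubini, the integral against the product measure. *)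
Fixpoint integrate_coords (s : seq 'I_k) (f : ('I_k -> Omega) -> R) u : R :=
  if s is i :: s' then
    \int[pi]_x integrate_coords s' f (fun j => if j == i then x else u j)
  else f u.

(* The value y at coordinates other than a and b is a placeholder: all of these
   coordinates are integrated out. *)
Definition T_op F (a b : 'I_k) W (z : Omega * Omega) : R :=
  integrate_coords [seq i <- enum 'I_k | (i != a) && (i != b)]
    (density F W) (fun i => if i == a then z.1 else z.2).

Definition velocity (Q : graph k -> graph k -> R) W (z : Omega * Omega) : R :=
  \sum_(F : graph k) \sum_(H : graph k) Q F H *
    \sum_(a < k) \sum_(b < k | a != b)
      T_op F a b W z *
      (([set a; b]%SET \in edges H :\: edges F)%:R -
       ([set a; b]%SET \in edges F :\: edges H)%:R).

(* Solution on [0, +oo[ of the differential equation, the derivative being taken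
   for the L^oo norm (one-sided at time 0). *)
Definition is_trajectory (Q : graph k -> graph k -> R) W
    (Phi : R -> Omega * Omega -> R) : Prop :=
  [/\ forall t, 0 <= t -> kernel_fun pi (Phi t),
      Phi 0 = W %[ae (pi \x pi)%E] &
      forall t, 0 <= t ->
        ('N[pi \x pi]_+oo [ (fun z =>
            (h^-1 * (Phi (t + h) z - Phi t z) - velocity Q (Phi t) z)%:E) ])%E
          @[h --> within [set h : R | 0 <= t + h] (0 : R)^'] --> 0%E].

End Velocity.

(* Main.v *)
Require Import Defs.
From HB Require Import structures.
From mathcomp Require Import all_boot all_order all_algebra.
From mathcomp Require Import all_classical all_reals all_analysis.
From mathcomp Require Import measurable_realfun ess_sup_inf.
From mathcomp Require Import ring lra.

(* Four parts carry a rigid 0/1 skeleton with two moving blocks, of densities u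
   and v.  The rule looks for a fixed labelled 8-vertex pattern that embeds in
   the skeleton in exactly one way, so that when it fires it knows the part of
   every sampled vertex; hence static blocks stay put, while the pairs sampled
   in moving blocks let any polynomial with suitable signs drive u and v.  The
   patterns are chosen so that
     u' = K u(1-u) v(1-v) (1-2v),   v' = K u(1-u) v(1-v) (2u-1),
   for which every circle around (1/2, 1/2) is invariant; the motion along one
   of them is solved in closed form. *)

Set Implicit Arguments.
Unset Strict Implicit.
Unset Printing Implicit Defensive.

Import Order.TTheory GRing.Theory Num.Theory.
Import numFieldNormedType.Exports.

Local Open Scope ring_scope.

(** * Patterns and rewiring rules *)

(** [None] leaves a pair free; only the entries with i < j are ever read. *)
Definition pattern (k : nat) := 'I_k -> 'I_k -> option bool.

Section Patterns.
Context (k : nat).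
Implicit Types (p : pattern k) (F : graph k).

Definition compatible (o : option bool) (b : bool) : bool :=
  if o is Some c then b == c else true.

Definition matches p F : bool :=
  [forall q : 'I_k * 'I_k, (q.1 < q.2)%N ==>
    compatible (p q.1 q.2) ([set q.1; q.2]%SET \in edges F)].

Definition weight (R : pzRingType) (o : option bool) (w : R) : R :=
  if o is Some b then (if b then w else 1 - w) else 1.

Lemma ltn_pair_set_inj (q r : 'I_k * 'I_k) :
  (q.1 < q.2)%N -> (r.1 < r.2)%N ->
  [set q.1; q.2]%SET = [set r.1; r.2]%SET -> q = r.
Proof.
case: q r => [i j] [i' j'] /= ij ij' /setP e.
have := e i; rewrite !inE eqxx /= => /esym/orP[]/eqP ei; last first.
  have := e i'; rewrite !inE eqxx /= => /orP[]/eqP ei'.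
    by move: ij'; rewrite ei' ei ltnn.
  by move: ij ij'; rewrite ei ei' => /ltn_trans h /h; rewrite ltnn.
have := e j; rewrite !inE eqxx orbT => /esym/orP[]/eqP ej.
  by move: ij; rewrite ei ej ltnn.
by rewrite ei ej.
Qed.

Definition pair_edges (J : {set 'I_k * 'I_k}) : {set {set 'I_k}} :=
  [set [set q.1; q.2]%SET | q in [set q in J | (q.1 < q.2)%N]]%SET.

Lemma pair_edges_card2 J : [forall e in pair_edges J, #|e| == 2%N].
Proof.
apply/forall_inP => e /imsetP[q]; rewrite inE => /andP[_ q12] ->.
by rewrite cards2 neq_ltn q12.
Qed.

Definition graph_of_pairs J : graph k := Graph (pair_edges_card2 J).

Lemma mem_graph_of_pairs J (q : 'I_k * 'I_k) : (q.1 < q.2)%N ->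
  ([set q.1; q.2]%SET \in edges (graph_of_pairs J)) = (q \in J).
Proof.
move=> q12; apply/imsetP/idP => [[r]|qJ]; last by exists q; rewrite // inE qJ.
by rewrite inE => /andP[rJ r12] /ltn_pair_set_inj ->.
Qed.

Lemma graph_eqP F F' :
  (forall q : 'I_k * 'I_k, (q.1 < q.2)%N ->
     ([set q.1; q.2]%SET \in edges F) = ([set q.1; q.2]%SET \in edges F')) ->
  F = F'.
Proof.
move=> FF'; apply/val_inj/setP => e /=.
have [e2|e2] := boolP (#|e| == 2%N); last first.
  have notin G : e \notin edges G.
    by apply: contra e2; case: G => G /= /forall_inP; exact.
  by rewrite (negbTE (notin F)) (negbTE (notin F')).
have /(cards2P e)[i [j [ij ->]]] := e2.
have [lt_ij|lt_ji|/val_inj eq_ij] := ltngtP i j.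
- exact: (FF' (i, j) lt_ij).
- by rewrite finset.setUC; exact: (FF' (j, i) lt_ji).
- by rewrite eq_ij eqxx in ij.
Qed.

Lemma sum_graph_distr (R : comPzRingType) (f g : 'I_k * 'I_k -> R) :
  \sum_(F : graph k) \prod_(q : 'I_k * 'I_k | (q.1 < q.2)%N)
     (if [set q.1; q.2]%SET \in edges F then f q else g q) =
  \prod_(q : 'I_k * 'I_k | (q.1 < q.2)%N) (f q + g q).
Proof.
(* With f extended by 0 and g by 1, the product runs over all ordered pairs and [bigA_distr] expands
   it over all sets of pairs; a set that contains a pair with q.1 >= q.2 contributes 0, and the
   other sets are exactly the graphs. *)
pose f' (q : 'I_k * 'I_k) := if (q.1 < q.2)%N then f q else 0 : R.
pose g' (q : 'I_k * 'I_k) := if (q.1 < q.2)%N then g q else 1 : R.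
transitivity (\prod_q (f' q + g' q)); last first.
  rewrite [RHS]big_mkcond; apply: eq_bigr => q _; rewrite /f' /g'.
  by case: ifP => // _; rewrite add0r.
rewrite bigA_distr (bigID (fun J : {set 'I_k * 'I_k} =>
  J \subset [set q : 'I_k * 'I_k | (q.1 < q.2)%N]%SET)) /= [X in _ + X]big1 ?addr0; last first.
  move=> J /fintype.subsetPn[q qJ]; rewrite inE => q12.
  by rewrite (bigD1 q) //= qJ /f' (negbTE q12) mul0r.
pose pairs (F : graph k) : {set 'I_k * 'I_k} :=
  [set q : 'I_k * 'I_k | (q.1 < q.2)%N && ([set q.1; q.2]%SET \in edges F)]%SET.
rewrite (reindex_onto pairs graph_of_pairs) /=; last first.
  move=> J /fintype.subsetP J12; apply/setP => q; rewrite !inE.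
  have [q12|] := boolP (q.1 < q.2)%N; first exact: mem_graph_of_pairs.
  by move=> q12; apply/esym/negP => /J12; rewrite inE (negbTE q12).
apply: eq_big => F.
  apply/esym/andP; split; last first.
    apply/eqP/graph_eqP => q q12.
    by rewrite mem_graph_of_pairs // inE q12.
  by apply/fintype.subsetP => q; rewrite !inE => /andP[].
move=> _; rewrite big_mkcond; apply: eq_bigr => q _; rewrite inE /f' /g'.
by case: ifP.
Qed.

(** The pairs are sampled independently, and a free pair contributes w + (1 - w) = 1. *)
Lemma sum_matches_prod (R : comPzRingType) p (w : 'I_k * 'I_k -> R) :
  \sum_(F : graph k) (matches p F)%:R * \prod_(q : 'I_k * 'I_k | (q.1 < q.2)%N)
    (if [set q.1; q.2]%SET \in edges F then w q else 1 - w q) =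
  \prod_(q : 'I_k * 'I_k | (q.1 < q.2)%N) weight (p q.1 q.2) (w q).
Proof.
pose f (q : 'I_k * 'I_k) := (compatible (p q.1 q.2) true)%:R * w q.
pose g (q : 'I_k * 'I_k) := (compatible (p q.1 q.2) false)%:R * (1 - w q).
transitivity (\prod_(q : 'I_k * 'I_k | (q.1 < q.2)%N) (f q + g q)); last first.
  apply: eq_bigr => q _; rewrite /f /g.
  by case: (p q.1 q.2) => [[]|] /=; rewrite ?(mul1r, mul0r, addr0, add0r) // addrC subrK.
rewrite -sum_graph_distr; apply: eq_bigr => F _.
have -> : (matches p F)%:R = \prod_(q : 'I_k * 'I_k | (q.1 < q.2)%N)
    (compatible (p q.1 q.2) ([set q.1; q.2]%SET \in edges F))%:R :> R.
  have [/forallP m|/forallPn[q]] := boolP (matches p F).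
    by rewrite big1 // => q q12; have := m q; rewrite q12 => /= ->.
  rewrite negb_imply => /andP[q12 /negbTE nc].
  by rewrite (bigD1 q) //= nc mul0r.
rewrite -big_split; apply: eq_bigr => q _ /=.
by rewrite /f /g; case: ifP.
Qed.

End Patterns.

Lemma density_pairs d (Omega : measurableType d) (R : realType) (k : nat)
    (F : graph k) (W : Omega * Omega -> R) (u : 'I_k -> Omega) :
  density F W u = \prod_(q : 'I_k * 'I_k | (q.1 < q.2)%N)
    (if [set q.1; q.2]%SET \in edges F then W (u q.1, u q.2)
     else 1 - W (u q.1, u q.2)).
Proof.
rewrite /density !pair_big_dep /= [RHS](bigID
  (fun q : 'I_k * 'I_k => [set q.1; q.2]%SET \in edges F)) /=.
by congr (_ * _); apply: eq_bigr => q /andP[_]; [move=> ->|move/negbTE ->].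
Qed.

Lemma set2_eq (T : finType) (a b i j : T) : a != b ->
  ([set a; b]%SET == [set i; j]%SET) =
  ((a, b) == (i, j)) || ((a, b) == (j, i)).
Proof.
move=> ab; apply/eqP/orP => [/setP e|[]/eqP[-> ->] //]; last exact: finset.setUC.
move: (e a) (e b); rewrite !inE !eqxx orbT /=.
case/esym/orP=> /eqP eqa /esym/orP[]/eqP eqb; subst a b;
  by rewrite ?eqxx in ab *; auto.
Qed.

Section Rewiring.
Context (k : nat) (i j : 'I_k) (pA pB : pattern k).
Hypotheses (ij : (i < j)%N).
Hypotheses (pAij : pA i j = Some false) (pBij : pB i j = Some true).

(** The default [F] of [insubd] is never reached: both new edge sets still consist of 2-subsets. *)
Definition rewire (F : graph k) : graph k :=
  if matches pA F then insubd F ([set i; j]%SET |: edges F)%SET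
  else if matches pB F then insubd F (edges F :\ [set i; j]%SET)%SET
  else F.

Lemma edges_card2 (F : graph k) e : e \in edges F -> #|e| == 2%N.
Proof. by case: F => E /= /forall_inP; exact. Qed.

Lemma matches_edge p (F : graph k) b :
  p i j = Some b -> matches p F -> ([set i; j]%SET \in edges F) = b.
Proof. by move=> pij /forallP/(_ (i, j)); rewrite ij /= pij => /eqP. Qed.

(** [pA] demands a non-edge at the flipped pair and [pB] an edge, so every firing is a genuine
    change and at most one of the two patterns fires. *)
Lemma rewire_diff (R : pzRingType) (F : graph k) (e : {set 'I_k}) :
  (e \in edges (rewire F) :\: edges F)%:R -
  (e \in edges F :\: edges (rewire F))%:R =
  (e == [set i; j]%SET)%:R * ((matches pA F)%:R - (matches pB F)%:R) :> R.
Proof.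
rewrite /rewire; have [mA|_] := boolP (matches pA F).
  have eF := matches_edge pAij mA.
  have -> : matches pB F = false.
    by apply/negP => /(matches_edge pBij); rewrite eF.
  rewrite val_insubd ifT; last first.
    apply/forall_inP => x; rewrite !inE => /orP[/eqP->|/edges_card2 //].
    by rewrite cards2 neq_ltn ij.
  rewrite !inE subr0 mulr1; case: eqVneq => [->|_] /=; rewrite ?eF /= ?subr0 //.
  by rewrite andNb subr0.
have [mB|_] := boolP (matches pB F); last first.
  by rewrite !inE andNb !subr0 mulr0.
have eF := matches_edge pBij mB.
rewrite val_insubd ifT; last first.
  by apply/forall_inP => x; rewrite !inE => /andP[_ /edges_card2].
rewrite !inE; case: eqVneq => [->|_] /=; rewrite ?eF /= ?sub0r ?mul1r //.
by rewrite andNb subr0 mul0r.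
Qed.

Section Flow.
Context d (Omega : measurableType d) (R : realType) (pi : probability Omega R).

(** The velocity of the deterministic rule that sends each F to [rewire F]. *)
Definition flow (W : Omega * Omega -> R) (z : Omega * Omega) : R :=
  \sum_(F : graph k) ((matches pA F)%:R - (matches pB F)%:R) *
    (T_op pi F i j W z + T_op pi F j i W z).

Lemma sum_rewire_diff (G : 'I_k -> 'I_k -> R) F :
  \sum_(a < k) \sum_(b < k | a != b) G a b *
    (([set a; b]%SET \in edges (rewire F) :\: edges F)%:R -
     ([set a; b]%SET \in edges F :\: edges (rewire F))%:R) =
  ((matches pA F)%:R - (matches pB F)%:R) * (G i j + G j i).
Proof.
have nij : i != j by rewrite neq_ltn ij.
rewrite pair_big_dep /= (bigD1 (i, j)) //= (bigD1 (j, i)) /=; last first.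
  by rewrite eq_sym nij -pair_eqE /= negb_and (eq_sym j i) nij.
rewrite big1 => [|q /andP[/andP[qab qij] qji]].
  rewrite !rewire_diff (finset.setUC [set j]%SET) eqxx !mul1r; ring.
rewrite rewire_diff set2_eq // -surjective_pairing.
by rewrite (negbTE qij) (negbTE qji) mul0r mulr0.
Qed.

End Flow.
End Rewiring.

Section MixedRule.
Context (R : realType) (k : nat) (r1 r2 : graph k -> graph k) (l : R).

Definition mixed_rule (F H : graph k) : R :=
  l * (H == r1 F)%:R + (1 - l) * (H == r2 F)%:R.

Lemma sum_mixed_rule F (f : graph k -> R) :
  \sum_(H : graph k) mixed_rule F H * f H = l * f (r1 F) + (1 - l) * f (r2 F).
Proof.
have sum1 a r : \sum_(H : graph k) a * (H == r)%:R * f H = a * f r.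
  rewrite (bigD1 r) //= eqxx mulr1 big1 ?addr0 // => H /negbTE ->.
  by rewrite mulr0 mul0r.
by under eq_bigr do rewrite mulrDl; rewrite big_split /= !sum1.
Qed.

Lemma is_rule_mixed : 0 <= l <= 1 -> is_rule mixed_rule.
Proof.
move=> /andP[l0 l1]; split => [F H|F].
  by rewrite /mixed_rule; do 2 case: (_ == _); rewrite /= ?mulr1 ?mulr0; lra.
under eq_bigr do rewrite -[mixed_rule _ _]mulr1.
by rewrite (sum_mixed_rule F (fun=> 1)); lra.
Qed.

End MixedRule.

Lemma velocity_mixed_rule d (Omega : measurableType d) (R : realType)
    (pi : probability Omega R) (k : nat) (l : R) (i j i' j' : 'I_k)
    (pA pB pA' pB' : pattern k) (W : Omega * Omega -> R) (z : Omega * Omega) :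
  (i < j)%N -> pA i j = Some false -> pB i j = Some true ->
  (i' < j')%N -> pA' i' j' = Some false -> pB' i' j' = Some true ->
  velocity pi (mixed_rule (rewire i j pA pB) (rewire i' j' pA' pB') l) W z =
  l * flow i j pA pB pi W z + (1 - l) * flow i' j' pA' pB' pi W z.
Proof.
move=> ij pAij pBij ij' pAij' pBij'; rewrite /velocity.
under eq_bigr do rewrite sum_mixed_rule !sum_rewire_diff //.
by rewrite big_split /= -!mulr_sumr.
Qed.

(** * Step kernels *)

Section StepFunctions.
Context d (Omega : measurableType d) (R : realType) (pi : probability Omega R).
Context (C : finType) (cls : Omega -> C).
Hypothesis mcls : forall x, measurable ((cls @^-1` [set x])%classic).

Definition part_mass (x : C) : R := fine (pi ((cls @^-1` [set x])%classic)).

Lemma Rintegral_step (h : C -> R) :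
  \int[pi]_x h (cls x) = \sum_x part_mass x * h x.
Proof.
have part_sum x : (h (cls x))%:E =
    (\sum_(c : C) (h c)%:E * (\1_((cls @^-1` [set c])%classic) x)%:E)%E.
  rewrite (bigD1 (cls x)) //= indicE mem_set //= mule1 big1 ?adde0 // => c cx.
  by rewrite indicE memNset ?mule0 // => /esym/eqP; rewrite (negbTE cx).
rewrite /Rintegral; under eq_integral do rewrite part_sum.
rewrite integral_sum //; last first.
  move=> c; apply: integrableZl => //.
  rewrite -[X in integrable _ _ X]/(EFin \o \1_((cls @^-1` [set c])%classic)).
  exact: integrable_indic.
rewrite -[RHS]/(fine (\sum_(x : C) part_mass x * h x)%:E) -sumEFin.
congr fine; apply: eq_bigr => c _; rewrite integralZl //; last first.
  rewrite -[X in integrable _ _ X]/(EFin \o \1_((cls @^-1` [set c])%classic)).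
  exact: integrable_indic.
rewrite integral_indic // setIT EFinM fineK ?fin_num_measure // muleC //.
Qed.

Section SumCoords.
Context (k : nat).
Implicit Types (s : seq 'I_k) (g : ('I_k -> C) -> R) (c : 'I_k -> C).

(** Finite counterpart of [integrate_coords] for integrands that see only the parts of the
    vertices. *)
Fixpoint sum_coords s g c : R :=
  if s is i :: s' then
    \sum_x part_mass x * sum_coords s' g (fun j => if j == i then x else c j)
  else g c.

Lemma integrate_coords_step s g (u : 'I_k -> Omega) :
  integrate_coords pi s (fun v => g (cls \o v)) u = sum_coords s g (cls \o u).
Proof.
elim: s u => [//|i s IH] u /=.
under eq_Rintegral => x _.
  rewrite IH (_ : cls \o _ = fun j => if j == i then cls x else (cls \o u) j).
    over.
  by apply/funext => j /=; case: ifP.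
by rewrite (Rintegral_step (fun x => sum_coords s g
  (fun j => if j == i then x else (cls \o u) j))).
Qed.

Lemma sum_coords_sum (I : finType) s (a : I -> R) (g : I -> ('I_k -> C) -> R) c :
  sum_coords s (fun c' => \sum_i a i * g i c') c =
  \sum_i a i * sum_coords s (g i) c.
Proof.
elim: s c => [//|m s IH] c /=.
under eq_bigr do rewrite IH mulr_sumr.
rewrite exchange_big; apply: eq_bigr => i _; rewrite mulr_sumr.
by apply: eq_bigr => x _; rewrite mulrCA.
Qed.

(** An integrand supported on the single placement [c0] leaves the product of the masses of the
    integrated parts, provided the kept coordinates already agree with [c0]. *)
Lemma sum_coords_point s (c0 c : 'I_k -> C) (v : R) : uniq s ->
  sum_coords s (fun c' => if [forall m, c' m == c0 m] then v else 0) c =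
  if [forall m, (m \notin s) ==> (c m == c0 m)]
  then \prod_(m <- s) part_mass (c0 m) * v else 0.
Proof.
elim: s c => [|i s IH] c /=.
  by move=> _; rewrite big_nil mul1r; congr (if _ then _ else _); apply: eq_forallb.
move=> /andP[is_ us]; rewrite (bigD1 (c0 i)) //= IH // big_cons -mulrA.
rewrite [X in _ + X]big1 ?addr0 => [|x xi]; last first.
  rewrite IH // ifF ?mulr0 //; apply/negP => /forallP/(_ i).
  by rewrite is_ eqxx (negbTE xi).
rewrite (_ : [forall m, _] = [forall m, (m \notin i :: s) ==> (c m == c0 m)]).
  by case: ifP => //; rewrite mulr0.
apply: eq_forallb => m; rewrite in_cons negb_or.
by case: (m =P i) => [->|] //=; rewrite eqxx implybT.
Qed.

End SumCoords.

Definition step_kernel (w : C -> C -> R) (z : Omega * Omega) : R :=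
  w (cls z.1) (cls z.2).

Section StepFlow.
Context (k : nat) (i j : 'I_k) (pA pB : pattern k) (w : C -> C -> R).
Hypothesis ij : i != j.

(** For w with values in [0, 1], the probability that the sampled graph matches [p] given the parts
    [c] of its vertices. *)
Definition pattern_weight (p : pattern k) (c : 'I_k -> C) : R :=
  \prod_(q : 'I_k * 'I_k | (q.1 < q.2)%N) weight (p q.1 q.2) (w (c q.1) (c q.2)).

Lemma sum_matches_T_op (a b : 'I_k) p z :
  \sum_(F : graph k) (matches p F)%:R * T_op pi F a b (step_kernel w) z =
  sum_coords [seq m <- enum 'I_k | (m != a) && (m != b)] (pattern_weight p)
    (fun m => if m == a then cls z.1 else cls z.2).
Proof.
pose dens (F : graph k) (c : 'I_k -> C) :=
  \prod_(q : 'I_k * 'I_k | (q.1 < q.2)%N)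
    (if [set q.1; q.2]%SET \in edges F then w (c q.1) (c q.2)
     else 1 - w (c q.1) (c q.2)).
have densE F : density F (step_kernel w) = fun u => dens F (cls \o u).
  by apply/funext => u; rewrite density_pairs.
under eq_bigr do rewrite /T_op densE integrate_coords_step.
rewrite -sum_coords_sum.
rewrite (_ : cls \o _ = fun m => if m == a then cls z.1 else cls z.2).
  congr sum_coords; apply/funext => c.
  exact: (sum_matches_prod p (fun q => w (c q.1) (c q.2))).
by apply/funext => m /=; case: ifP.
Qed.

(** Both patterns have [c0] as their only possible placement, so an edge can change only between the
    parts of i and j; the two indicators come from the two orders of the flipped pair. *)
Lemma flow_step (c0 : 'I_k -> C) (vA vB : R) z :
  (forall c, pattern_weight pA c = if [forall m, c m == c0 m] then vA else 0) ->
  (forall c, pattern_weight pB c = if [forall m, c m == c0 m] then vB else 0) ->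
  flow i j pA pB pi (step_kernel w) z =
  \prod_(m | (m != i) && (m != j)) part_mass (c0 m) * (vA - vB) *
  (((cls z.1, cls z.2) == (c0 i, c0 j))%:R +
   ((cls z.1, cls z.2) == (c0 j, c0 i))%:R).
Proof.
move=> hA hB.
have T_opE (a b : 'I_k) p v : a != b ->
    (forall c, pattern_weight p c = if [forall m, c m == c0 m] then v else 0) ->
    \sum_(F : graph k) (matches p F)%:R * T_op pi F a b (step_kernel w) z =
    \prod_(m | (m != a) && (m != b)) part_mass (c0 m) * v *
    ((cls z.1, cls z.2) == (c0 a, c0 b))%:R.
  move=> ab /funext hp; have ba : (b == a) = false by rewrite eq_sym (negbTE ab).
  rewrite sum_matches_T_op hp sum_coords_point; last exact/filter_uniq/enum_uniq.
  rewrite big_filter big_enum_cond /= -pair_eqE /=.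
  rewrite (_ : [forall m, _] = (cls z.1 == c0 a) && (cls z.2 == c0 b)).
    by case: ifP; rewrite ?mulr1 ?mulr0.
  apply/forallP/andP => [h|[/eqP h1 /eqP h2] m].
    by have := h a; have := h b; rewrite !mem_filter !eqxx /= andbF ba.
  apply/implyP; rewrite mem_filter mem_enum andbT negb_and !negbK.
  by case/orP => /eqP ->; rewrite ?eqxx ?ba ?h1 ?h2.
rewrite /flow; under [LHS]eq_bigr do rewrite mulrBl 2!mulrDr.
rewrite sumrB !big_split /= !(T_opE i j _ _ ij hA) !(T_opE i j _ _ ij hB).
have ji : j != i by rewrite eq_sym.
rewrite !(T_opE j i _ _ ji hA) !(T_opE j i _ _ ji hB).
rewrite (eq_bigl _ _ (fun m => andbC (m != j) (m != i))).
ring.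
Qed.

End StepFlow.
End StepFunctions.

(** * The skeleton and its patterns *)

Definition part := (bool * bool)%type.

(* Parts (false, false) and (false, true) are independent sets, the other two
   are cliques.  The two pairs of parts with the same first component carry the
   moving densities; all other densities are 0 or 1. *)
Definition skeleton (x y : part) : option bool :=
  if x.1 == y.1 then (if x.2 == y.2 then Some x.1 else None)
  else Some (x.2 && y.2).

(** Reading only [x.1] keeps this symmetric: in a moving block both parts have the same first
    component. *)
Definition block_value (R : pzRingType) (u v : R) (x y : part) : R :=
  if skeleton x y is Some b then b%:R else if x.1 then v else u.

Definition parts : seq part :=
  [:: (false, false); (false, true); (true, false); (true, true)].

Definition target : seq part :=
  [:: (false, false); (false, true); (false, true); (false, true);
      (true, false); (true, true); (true, true); (true, true)].

Definition target_part (i : nat) : part := nth (false, false) target i.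

(** The moving pairs of the target are (0, j) for j = 1, 2, 3, prescribed by [f], and (4, j) for j =
    5, 6, 7, prescribed by [g]; hence the shifts by 1 and 5. All other pairs copy the skeleton. *)
Definition target_pattern (f g : seq (option bool)) (i j : nat) : option bool :=
  if skeleton (target_part i) (target_part j) is Some b then Some b
  else if i == 0%N then nth None f (j - 1)%N else nth None g (j - 5)%N.

(** * Exhaustive search for the placements of a pattern *)

Section Forcing.
Variable p : nat -> nat -> option bool.

Definition realizable (i j : nat) (x y : part) : bool :=
  if p i j is Some b then compatible (skeleton x y) b else true.

(** Depth-first search that places the vertices one by one and prunes at a pair contradicting a 0/1
    block. A moving block admits both values, so the outcome does not depend on u and v. *)
Fixpoint forced (n : nat) (s : seq part) : bool :=
  if n is n'.+1 then
    all (fun x =>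
      if all (fun i => realizable i (size s) (nth (false, false) s i) x)
           (iota 0 (size s)) then forced n' (rcons s x) else true) parts
  else s == target.

Lemma forcedP n s t : size t = n -> forced n s ->
  (forall i j, (i < j < size (s ++ t))%N -> realizable i j
     (nth (false, false) (s ++ t) i) (nth (false, false) (s ++ t) j)) ->
  s ++ t = target.
Proof.
elim: n s t => [|n IH] s [|x t] // => [_ /eqP <-|[tn] sx st]; first by rewrite cats0.
have {}sx := elimT seq.allP sx; rewrite -cat_rcons; apply: IH => //; last first.
  by move=> i j; rewrite cat_rcons; exact: st.
have /sx : x \in parts by case: x {st} => -[] [].
rewrite ifT //; apply/seq.allP => i; rewrite mem_iota /= add0n => i_s.
have := st i (size s); rewrite size_cat /= i_s -[ltnLHS]addn0 ltn_add2l => /(_ isT).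
by rewrite !nth_cat i_s ltnn subnn.
Qed.

End Forcing.

Section PatternWeight.
Context (R : realType) (u v : R).

Definition lift_pattern (p : nat -> nat -> option bool) : pattern 8 :=
  fun i j => p i j.

Lemma pattern_weight_forced p (c : 'I_8 -> part) : forced p 8 [::] ->
  pattern_weight (block_value u v) (lift_pattern p) c =
  if [forall m, c m == target_part m]
  then pattern_weight (block_value u v) (lift_pattern p) target_part else 0.
Proof.
move=> pF; have [/forallP ct|] := ifPn.
  by congr pattern_weight; apply/funext => m; exact/eqP.
(* A nonzero weight makes every pair realizable, since a pair contradicting a 0/1 block gives a
   factor 0; the search then identifies the placement. *)
apply: contraNeq => nz; apply/forallP => m.
have c_nth (i : 'I_8) : nth (false, false) (codom c) i = c i.
  by rewrite -[i in RHS](enum_rankK i) -(nth_codom (false, false)) enum_rank_ord.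
rewrite /target_part; suff <- : codom c = target by rewrite c_nth.
refine (@forcedP p 8 [::] (codom c) _ pF _); first by rewrite size_codom card_ord.
rewrite cat0s size_codom card_ord => i j /andP[ij j8].
have i8 := ltn_trans ij j8.
rewrite -[i]/(nat_of_ord (Ordinal i8)) -[j]/(nat_of_ord (Ordinal j8)) !c_nth.
move: nz; rewrite /pattern_weight (bigD1 (Ordinal i8, Ordinal j8)) //= mulf_eq0.
rewrite negb_or => /andP[+ _]; rewrite /lift_pattern /realizable /block_value /=.
case: (p i j) => // b; case: (skeleton _ _) => // -[]; case: b => //=.
  by rewrite subrr eqxx.
by rewrite eqxx.
Qed.

(** At the target each static pair agrees with the pattern and gives a factor 1, so only the six
    moving pairs remain. *)
Lemma pattern_weight_target f g :
  pattern_weight (block_value u v) (lift_pattern (target_pattern f g)) target_part =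
  \prod_(o <- [seq nth None f i | i <- iota 0 3]) weight o u *
  \prod_(o <- [seq nth None g i | i <- iota 0 3]) weight o v.
Proof.
pose F (i j : nat) := if (i < j)%N then weight (target_pattern f g i j)
  (block_value u v (target_part i) (target_part j)) else 1.
transitivity (\prod_(0 <= i < 8) \prod_(0 <= j < 8) F i j).
  rewrite big_mkord; under [RHS]eq_bigr do rewrite big_mkord.
  by rewrite pair_big /= /pattern_weight big_mkcond.
rewrite /index_iota /= !big_cons !big_nil /F /target_pattern /block_value /=.
by rewrite !subr0 !mulr1 !mul1r !subSS !subn0 !mulrA.
Qed.

End PatternWeight.

(* [b] is the state of the pair to be flipped.  Its insertion and deletion rates
   are u v (1-v)^2 and (1-u) v^2 (1-v) for [pattern_u], u^2 (1-u) v and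
   u (1-u)^2 (1-v) for [pattern_v]. *)
Definition pattern_u (b : bool) := target_pattern
  [:: Some b; Some (~~ b); None] [:: Some true; Some b; Some false].

Definition pattern_v (b : bool) := target_pattern
  [:: Some true; Some (~~ b); Some false] [:: Some b; Some (~~ b); None].

(** Uniqueness of the placement is a finite check among 4^8 candidates, which pruning makes
    small. *)
Lemma forced_pattern_u b : forced (pattern_u b) 8 [::].
Proof. by case: b; vm_compute. Qed.

Lemma forced_pattern_v b : forced (pattern_v b) 8 [::].
Proof. by case: b; vm_compute. Qed.

(** * The circulation rule and its velocity *)

Section Circulation.
Context d (Omega : measurableType d) (R : realType) (pi : probability Omega R).
Context (cls : Omega -> part).
Hypothesis mcls : forall x, measurable (cls @^-1` [set x])%classic.
Hypothesis mass_gt0 : forall x, 0 < part_mass pi cls x.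

Let vertex (i : nat) : 'I_8 := inord i.

Definition free_mass (i j : 'I_8) : R :=
  \prod_(m | (m != i) && (m != j)) part_mass pi cls (target_part m).

(* The mixing weight compensates for the two moving blocks having different
   masses, so that both densities move at the same speed. *)
Definition circulation_rule : graph 8 -> graph 8 -> R :=
  mixed_rule
    (rewire (vertex 0) (vertex 1) (lift_pattern (pattern_u false))
       (lift_pattern (pattern_u true)))
    (rewire (vertex 4) (vertex 5) (lift_pattern (pattern_v false))
       (lift_pattern (pattern_v true)))
    (free_mass (vertex 4) (vertex 5) /
     (free_mass (vertex 0) (vertex 1) + free_mass (vertex 4) (vertex 5))).

(** With p and q the two free masses, the mixing weights q / (p + q) and p / (p + q) turn the
    factors p and q into the common factor p q / (p + q). *)
Definition circulation_rate : R :=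
  free_mass (vertex 0) (vertex 1) * free_mass (vertex 4) (vertex 5) /
  (free_mass (vertex 0) (vertex 1) + free_mass (vertex 4) (vertex 5)).

Lemma free_mass_gt0 i j : 0 < free_mass i j.
Proof. by apply: prodr_gt0 => m _; exact: mass_gt0. Qed.

Lemma circulation_rate_gt0 : 0 < circulation_rate.
Proof. by rewrite divr_gt0 ?mulr_gt0 ?addr_gt0 ?free_mass_gt0. Qed.

Lemma is_rule_circulation : is_rule circulation_rule.
Proof.
apply: is_rule_mixed; have := free_mass_gt0 (vertex 0) (vertex 1).
have := free_mass_gt0 (vertex 4) (vertex 5).
move: (free_mass _ _) (free_mass _ _) => p q p0 q0.
have pq0 := addr_gt0 q0 p0.
by rewrite ler_pdivlMr ?ler_pdivrMr ?(mul0r, mul1r); lra.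
Qed.

Definition block_speed (du dv : R) (x y : part) : R :=
  if skeleton x y is None then (if x.1 then dv else du) else 0.

Lemma velocity_circulation (u v : R) z :
  velocity pi circulation_rule (step_kernel cls (block_value u v)) z =
  block_speed (circulation_rate * (u * (1 - u) * (v * (1 - v))) * (1 - 2 * v))
              (circulation_rate * (u * (1 - u) * (v * (1 - v))) * (2 * u - 1))
              (cls z.1) (cls z.2).
Proof.
rewrite /circulation_rule velocity_mixed_rule //;
  try by rewrite /lift_pattern ?inordK.
have v01 : vertex 0 != vertex 1 by rewrite -val_eqE /= !inordK.
have v45 : vertex 4 != vertex 5 by rewrite -val_eqE /= !inordK.
have pu b c := pattern_weight_forced u v c (forced_pattern_u b).
have pv b c := pattern_weight_forced u v c (forced_pattern_v b).
rewrite (flow_step pi mcls v01 z (pu false) (pu true)).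
rewrite (flow_step pi mcls v45 z (pv false) (pv true)).
rewrite -!/(free_mass _ _) !pattern_weight_target /= !big_cons !big_nil /=.
rewrite !inordK // /circulation_rate.
have := lt0r_neq0 (addr_gt0 (free_mass_gt0 (vertex 0) (vertex 1))
                            (free_mass_gt0 (vertex 4) (vertex 5))).
move: (free_mass _ _) (free_mass _ _) => q p pq0.
have -> : 1 - q / (p + q) = p / (p + q) by field.
rewrite /target_part /=.
(* The flipped pairs (0, 1) and (4, 5) join the two distinct parts of their moving block, so in each
   orientation of that block exactly one indicator is 1. *)
by case: (cls z.1) => -[] []; case: (cls z.2) => -[] []; rewrite /block_speed /=
  ?(mulr0n, mulr1n, addr0, add0r, mulr0, mulr1); field.
Qed.

End Circulation.

(** * The explicit circular motion *)

Section Oscillation.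
Context (R : realType).
Implicit Types (x t : R).

Lemma cos2Dsin2_gt0 (a x : R) : 0 < a -> 0 < cos x ^+ 2 + a * sin x ^+ 2.
Proof.
move=> a0; rewrite cos2sin2; have := cos2Dsin2 x; have := sqr_ge0 (cos x).
have := sqr_ge0 (sin x); rewrite le_eqVlt => /predU1P[<-|s0] c0 cs.
  by rewrite mulr0 subr0 addr0.
by have := mulr_gt0 a0 s0; lra.
Qed.

Section Phase.
Variable k : R.
Hypothesis k0 : 0 < k.

Definition phase_ellipse x : R := cos x ^+ 2 + k * sin x ^+ 2.

Definition phase_shift x : R := (k - 1) * (sin x * cos x) / phase_ellipse x.

(** The continuous branch of arctan (k tan x): by the subtraction formula [phase_shift] is the
    tangent of arctan (k tan x) - x, written with a denominator that never vanishes. *)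
Definition phase x : R := x + atan (phase_shift x).

Let phase_ellipse_neq0 x : phase_ellipse x != 0.
Proof. exact/lt0r_neq0/cos2Dsin2_gt0. Qed.

Let phase_denominator_neq0 x : cos x ^+ 2 + k ^+ 2 * sin x ^+ 2 != 0.
Proof. by apply/lt0r_neq0/cos2Dsin2_gt0; rewrite exprn_gt0. Qed.

(** Lagrange's identity for the vectors (cos x, sin x) and (cos x, k sin x), whose scalar product is
    [phase_ellipse x] and whose determinant is (k - 1) sin x cos x. *)
Lemma phase_shift_sq x : 1 + phase_shift x ^+ 2 =
  (cos x ^+ 2 + k ^+ 2 * sin x ^+ 2) / phase_ellipse x ^+ 2.
Proof.
have D0 := phase_ellipse_neq0 x.
have -> : cos x ^+ 2 + k ^+ 2 * sin x ^+ 2 =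
    phase_ellipse x ^+ 2 + ((k - 1) * (sin x * cos x)) ^+ 2.
  by rewrite /phase_ellipse !exprMn cos2sin2; ring.
by rewrite /phase_shift; field.
Qed.

(** [phase x] is the polar angle of the vector (cos x, k sin x). *)
Lemma sin_phase_sq x : sin (phase x) ^+ 2 =
  k ^+ 2 * sin x ^+ 2 / (cos x ^+ 2 + k ^+ 2 * sin x ^+ 2).
Proof.
have D0 := phase_ellipse_neq0 x.
have N0 := phase_denominator_neq0 x.
have q0 : 0 < 1 + phase_shift x ^+ 2 by rewrite ltr_pwDl ?sqr_ge0.
have ca2 : cos (atan (phase_shift x)) ^+ 2 = (1 + phase_shift x ^+ 2)^-1.
  by rewrite cos_atan exprVn sqr_sqrtr // ltW.
have ca0 : cos (atan (phase_shift x)) != 0.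
  by rewrite -sqrf_eq0 ca2 invr_eq0 lt0r_neq0.
have sa : sin (atan (phase_shift x)) =
    phase_shift x * cos (atan (phase_shift x)).
  by rewrite -[X in X * _]atanK /tan divfK.
have -> : sin (phase x) =
    cos (atan (phase_shift x)) * (k * sin x / phase_ellipse x).
  rewrite /phase sinD sa.
  have -> : k * sin x / phase_ellipse x =
      (sin x * phase_ellipse x + (k - 1) * sin x * cos x ^+ 2) / phase_ellipse x.
    by rewrite {2}/phase_ellipse cos2sin2; congr (_ / _); ring.
  by rewrite /phase_shift; field.
rewrite exprMn ca2 phase_shift_sq; field.
by rewrite exprMn N0 D0.
Qed.

Lemma is_derive_phase x :
  is_derive x 1 phase (k / (cos x ^+ 2 + k ^+ 2 * sin x ^+ 2)).
Proof.
have D0 := phase_ellipse_neq0 x.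
have N0 := phase_denominator_neq0 x.
have dD : is_derive x 1 phase_ellipse (2 * (k - 1) * (sin x * cos x)).
  apply: is_derive_eq; rewrite /GRing.scale /=; ring.
have dV := is_deriveV D0 dD.
have dS : is_derive x 1 phase_shift ((k - 1) * ((cos x ^+ 2 - sin x ^+ 2) *
    phase_ellipse x - 2 * (k - 1) * (sin x * cos x) ^+ 2) / phase_ellipse x ^+ 2).
  apply: is_derive_eq; rewrite /GRing.scale /=; field; exact: D0.
apply: is_derive_eq; rewrite phase_shift_sq.
move: D0 N0; rewrite /phase_ellipse exprMn cos2sin2.
move: (sin x ^+ 2) => S D0 N0; field.
by rewrite N0 D0.
Qed.

Lemma phaseD2pi x : phase (x + pi *+ 2) = phase x + pi *+ 2.
Proof.
by rewrite /phase /phase_shift /phase_ellipse cosD2pi sinD2pi addrAC.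
Qed.

End Phase.

(* The circle (2u-1)^2 + (2v-1)^2 = (4/5)^2 is invariant under
   [u' = 8 s u(1-u)v(1-v)(1-2v)], [v' = 8 s u(1-u)v(1-v)(2u-1)]; on it, twice the
   polar angle p of (2u-1, 2v-1) solves p' = s (a + b sin^2 p) with a = 18/25 and b = 128/625, whose
   solution is [phase k (w s t)] with k^2 = a / (a + b) and w = a / k. *)
Section Orbit.
Variable s : R.
Hypothesis s0 : 0 < s.

Definition orbit_angle (t : R) : R :=
  2^-1 * phase (15%:R / 17%:R) (102%:R / 125%:R * s * t).

Definition orbit_u (t : R) : R := 2^-1 * (1 + 4%:R / 5%:R * cos (orbit_angle t)).
Definition orbit_v (t : R) : R := 2^-1 * (1 + 4%:R / 5%:R * sin (orbit_angle t)).

Definition orbit_speed (t : R) : R :=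
  8%:R * s * (orbit_u t * (1 - orbit_u t) * (orbit_v t * (1 - orbit_v t))).

Lemma is_derive_orbit_angle t : is_derive t 1 orbit_angle (2 * orbit_speed t).
Proof.
pose x := 102%:R / 125%:R * s * t.
have k0 : 0 < 15%:R / 17%:R :> R by rewrite divr_gt0.
have dp := is_derive_phase k0 x.
have dx : is_derive t 1 (fun t : R => 102%:R / 125%:R * s * t) (102%:R / 125%:R * s).
  by apply: is_derive_eq; rewrite /GRing.scale /= mulr1.
have := is_derive1_comp dp dx.
have sp := sin_phase_sq k0 x.
have N0 : cos x ^+ 2 + (15%:R / 17%:R) ^+ 2 * sin x ^+ 2 != 0.
  by apply/lt0r_neq0/cos2Dsin2_gt0; rewrite exprn_gt0.
move=> dcomp; rewrite /orbit_angle.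
apply: is_derive_eq; rewrite /orbit_speed /orbit_u /orbit_v /orbit_angle -/x.
have sp2 : sin (phase (15%:R / 17%:R) x) =
    2 * (sin (2^-1 * phase (15%:R / 17%:R) x) * cos (2^-1 * phase (15%:R / 17%:R) x)).
  rewrite -{1}[phase _ x](_ : (2^-1 * phase (15%:R / 17%:R) x) *+ 2 = _) //.
    by rewrite sin_mulr2n; ring.
  by field.
(* This is half of s (a + b sin^2 p), because the orbit angle is p / 2. *)
transitivity (s * (9%:R / 25%:R + 64%:R / 625%:R * sin (phase (15%:R / 17%:R) x) ^+ 2)).
  move: N0; rewrite sp cos2sin2 /GRing.scale /=; move: (sin x ^+ 2) => S N0.
  by field; lra.
rewrite sp2; have := cos2sin2 (2^-1 * phase (15%:R / 17%:R) x).
move: (cos _) (sin _) => C S CS.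
rewrite [in LHS]exprMn [in LHS]exprMn CS.
(* On the circle 4 u (1 - u) = 1 - (4/5)^2 C^2, and likewise for v with S; expanding leaves 9/25 +
   (256/625) C^2 S^2. *)
transitivity (s * (1 - (4%:R / 5%:R) ^+ 2 * C ^+ 2) * (1 - (4%:R / 5%:R) ^+ 2 * S ^+ 2)).
  by rewrite CS; field.
by field.
Qed.

Lemma is_derive_orbit_u t :
  is_derive t 1 orbit_u (orbit_speed t * (1 - 2 * orbit_v t)).
Proof.
have dA := is_derive_orbit_angle t.
have := is_derive1_comp (is_derive_cos (orbit_angle t)) dA => dC.
rewrite /orbit_u; apply: is_derive_eq; rewrite /GRing.scale /= /orbit_v.
by field.
Qed.

Lemma is_derive_orbit_v t :
  is_derive t 1 orbit_v (orbit_speed t * (2 * orbit_u t - 1)).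
Proof.
have dA := is_derive_orbit_angle t.
have := is_derive1_comp (is_derive_sin (orbit_angle t)) dA => dC.
rewrite /orbit_v; apply: is_derive_eq; rewrite /GRing.scale /= /orbit_u.
by field.
Qed.

(** The time in which the argument of [phase] grows by 2 pi: the orbit angle then grows by pi, which
    leads to the antipodal point (1 - u, 1 - v). *)
Definition orbit_half_period : R := pi *+ 2 / (102%:R / 125%:R * s).

Lemma orbit_half_period_gt0 : 0 < orbit_half_period.
Proof.
by apply: divr_gt0; [rewrite pmulrn_lgt0 ?pi_gt0|rewrite mulr_gt0 ?divr_gt0].
Qed.

Lemma orbit_angle_half_period t :
  orbit_angle (t + orbit_half_period) = orbit_angle t + pi.
Proof.
rewrite /orbit_angle /orbit_half_period.
rewrite (_ : _ * s * (_ + _) = 102%:R / 125%:R * s * t + pi *+ 2); last first.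
  by field; rewrite lt0r_neq0.
by rewrite phaseD2pi; field.
Qed.

Lemma orbit_u_half_period t : orbit_u (t + orbit_half_period) = 1 - orbit_u t.
Proof. by rewrite /orbit_u orbit_angle_half_period cosDpi; field. Qed.

Lemma orbit_v_half_period t : orbit_v (t + orbit_half_period) = 1 - orbit_v t.
Proof. by rewrite /orbit_v orbit_angle_half_period sinDpi; field. Qed.

Lemma orbit_u_itv t : 0 <= orbit_u t <= 1.
Proof.
have := cos_le1 (orbit_angle t); have := cos_geN1 (orbit_angle t).
by rewrite /orbit_u; lra.
Qed.

Lemma orbit_v_itv t : 0 <= orbit_v t <= 1.
Proof.
have := sin_le1 (orbit_angle t); have := sin_geN1 (orbit_angle t).
by rewrite /orbit_v; lra.
Qed.

(** The orbit starts at angle 0, where u = 9/10. *)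
Lemma orbit_u0_neq : orbit_u 0 != 1 - orbit_u 0.
Proof.
rewrite /orbit_u /orbit_angle mulr0 /phase /phase_shift sin0 mul0r mulr0 mul0r.
by rewrite atan0 addr0 mulr0 cos0; apply/eqP => e; lra.
Qed.

End Orbit.
End Oscillation.

(** * From atomless spaces to trajectories *)

Section Partition.
Context d (Omega : measurableType d) (R : realType) (pi : probability Omega R).
Local Open Scope classical_set_scope.

Lemma atomless_split (A : set Omega) : atomless pi ->
  measurable A -> (0 < pi A)%E ->
  exists B, [/\ measurable B, B `<=` A, (0 < pi B)%E & (0 < pi (A `\` B))%E].
Proof.
move=> at_pi mA A0; have [B [mB BA B0 BltA]] := at_pi A mA A0.
exists B; split=> //; rewrite measureD ?setIidr //; first by rewrite sube_gt0.
by rewrite -ge0_fin_numE // fin_num_measure.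
Qed.

Lemma atomless_partition : atomless pi -> exists cls : Omega -> part,
  (forall x, measurable (cls @^-1` [set x])) /\
  (forall x, 0 < part_mass pi cls x).
Proof.
move=> at_pi.
have piT : (0 < pi setT)%E by rewrite probability_setT lte_fin.
have [S [mS _ S0 Sc0]] := atomless_split at_pi measurableT piT.
rewrite setTD in Sc0; have mSc := measurableC mS.
have [S1 [mS1 S1S S10 S11]] := atomless_split at_pi mS S0.
have [S2 [mS2 S2S S20 S21]] := atomless_split at_pi mSc Sc0.
(* The first component tells S from its complement, the second tells the chosen piece of that half
   from the rest. *)
pose cls (o : Omega) : part := (`[< S o >], `[< S1 o \/ S2 o >]).
have clsE x : cls @^-1` [set x] = match x with
    | (true, true) => S1 | (true, false) => S `\` S1
    | (false, true) => S2 | (false, false) => ~` S `\` S2 end.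
  apply/seteqP; split => o; rewrite /cls /=.
    move=> <-; case: asboolP => So; case: asboolP => //.
    - by case=> // /S2S.
    - by move/not_orP => [].
    - by case=> // /S1S.
    - by move/not_orP => [].
  case: x => -[] [].
  - by move=> S1o; congr pair; apply/asboolT; [exact: S1S|left].
  - move=> [So nS1o]; congr pair; first exact/asboolT.
    by apply/asboolF => -[|/S2S].
  - by move=> S2o; congr pair; [apply/asboolF; exact: S2S|apply/asboolT; right].
  - move=> [nSo nS2o]; congr pair; first exact/asboolF.
    by apply/asboolF => -[/S1S|].
exists cls; split => x; rewrite ?/part_mass clsE.
  by case: x => -[] [] //; exact: measurableD.
apply: fine_gt0; rewrite -ge0_fin_numE // fin_num_measure ?andbT.
  by case: x => -[] [].
by case: x => -[] [] //; exact: measurableD.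
Qed.

End Partition.

(** * Moving step kernels as trajectories *)

Section Trajectory.
Context d (Omega : measurableType d) (R : realType) (pi : probability Omega R).
Local Open Scope classical_set_scope.
Context (cls : Omega -> part).
Hypothesis mcls : forall x, measurable (cls @^-1` [set x]).
Hypothesis mass_gt0 : forall x, 0 < part_mass pi cls x.

Lemma measurable_step_kernel (w : part -> part -> R) :
  measurable_fun setT (step_kernel cls w).
Proof.
pose cell (p : part * part) :=
  ((cls @^-1` [set p.1]) `*` (cls @^-1` [set p.2]))%classic.
have -> : step_kernel cls w = fun z => \sum_p w p.1 p.2 * \1_(cell p) z.
  apply/funext => z; rewrite (bigD1 (cls z.1, cls z.2)) //= indicE mem_set //.
  rewrite mulr1 big1 ?addr0 // => -[x y] /= xy; rewrite indicE memNset ?mulr0 //.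
  by move=> -[/= zx zy]; rewrite zx zy eqxx in xy.
apply: measurable_sum => p; apply: measurable_funM; first exact: measurable_cst.
by apply: measurable_indic; exact: measurableX.
Qed.

Lemma block_value_sym (u v : R) x y : block_value u v x y = block_value u v y x.
Proof. by case: x y => -[] [] [[] []]. Qed.

Lemma block_value_itv (u v : R) x y :
  0 <= u <= 1 -> 0 <= v <= 1 -> 0 <= block_value u v x y <= 1.
Proof.
by move=> u01 v01; rewrite /block_value; case: skeleton => [[]|];
  [rewrite lexx ler01|rewrite lexx ler01|case: ifP].
Qed.

Lemma graphon_step_kernel (u v : R) : 0 <= u <= 1 -> 0 <= v <= 1 ->
  graphon pi (step_kernel cls (block_value u v)).
Proof.
move=> u01 v01; have w01 x y := block_value_itv x y u01 v01.
split; last by apply: aeW => z; exact: w01.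
split; first exact: measurable_step_kernel.
- exists 1; split; first exact: num_real.
  move=> M M1 z _ /=; apply: (le_trans _ (ltW M1)).
  by have /andP[w0 w1] := w01 (cls z.1) (cls z.2); rewrite ger0_norm.
- by apply: aeW => z; exact: block_value_sym.
Qed.

Lemma Lnorm_infty_le (f : Omega * Omega -> R) (M : R) : 0 <= M ->
  (forall z, `|f z| <= M) ->
  ('N[(pi \x pi)%E]_+oo [ (fun z => (f z)%:E) ] <= M%:E)%E.
Proof.
(* The norm unfolds to an essential supremum if the total mass is positive and to 0 otherwise. *)
move=> M0 fM; rewrite unlock /=; case: ifP => _; last by rewrite lee_fin.
by apply/ess_supP; apply: aeW => z /=; rewrite lee_fin.
Qed.

Lemma is_derive_cvg (f : R -> R) (t df : R) : is_derive t 1 f df ->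
  h^-1 * (f (t + h) - f t) - df @[h --> (0 : R)^'] --> (0 : R).
Proof.
move=> [dfx <-].
have c : h^-1 * (f (t + h) - f t) @[h --> (0 : R)^'] --> 'D_1 f t.
  rewrite /derive; apply: cvg_trans dfx.
  by apply: near_eq_cvg; near=> h; rewrite /= /GRing.scale /= mulr1 (addrC h).
by have := cvgB c (cvg_cst ('D_1 f t)); rewrite subrr; exact.
Unshelve. all: by end_near. Qed.

(** Only two scalars move, so the error of the difference quotient is 0, [eu h] or [ev h] at every
    point, and its norm is at most |eu h| + |ev h|. *)
Lemma is_trajectory_block (Q : graph 8 -> graph 8 -> R) (u v du dv : R -> R) :
  (forall t, 0 <= u t <= 1) -> (forall t, 0 <= v t <= 1) ->
  (forall t : R, is_derive t 1 u (du t)) -> (forall t : R, is_derive t 1 v (dv t)) ->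
  (forall t z, velocity pi Q (step_kernel cls (block_value (u t) (v t))) z =
     block_speed (du t) (dv t) (cls z.1) (cls z.2)) ->
  is_trajectory pi Q (step_kernel cls (block_value (u 0) (v 0)))
    (fun t => step_kernel cls (block_value (u t) (v t))).
Proof.
move=> u01 v01 hu hv hV; split => [t _||t t0].
- by have [] := graphon_step_kernel (u01 t) (v01 t).
- by apply: aeW => z.
pose eu h := h^-1 * (u (t + h) - u t) - du t.
pose ev h := h^-1 * (v (t + h) - v t) - dv t.
(* Since u and v are differentiable on the whole line, the two-sided limit holds, also at time 0. *)
apply: cvg_within_filter.
have e0 : (`|eu h| + `|ev h|)%:E @[h --> (0 : R)^'] --> 0%E.
  apply: cvg_EFin; first by near=> h.
  rewrite [X in _ --> X](_ : _ = `|0 : R| + `|0 : R|); last by rewrite normr0 addr0.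
  by apply: cvgD; apply: cvg_norm; apply: is_derive_cvg.
apply: (squeeze_cvge _ (cvg_cst 0%E) e0).
near=> h; rewrite Lnorm_ge0 /=; apply: Lnorm_infty_le; first by rewrite addr_ge0.
move=> z; rewrite hV /step_kernel /block_value /block_speed.
case: skeleton => [b|]; first by rewrite !subrr mulr0 subrr normr0 addr_ge0.
by case: ifP => _; rewrite -?/(eu h) -?/(ev h) ?lerDl ?lerDr.
Unshelve. all: by end_near. Qed.

(** The kernels differ on the whole rectangle over the parts x and y, which has positive measure. *)
Lemma step_kernel_neq (w w' : part -> part -> R) x y : w x y != w' x y ->
  ~ (step_kernel cls w = step_kernel cls w' %[ae (pi \x pi)%E]).
Proof.
move=> ww' [N [mN N0 subN]].
pose cell := ((cls @^-1` [set x]) `*` (cls @^-1` [set y]))%classic.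
have cellN : (cell `<=` N)%classic.
  move=> z [/= zx zy]; apply: subN => /= /(_ I).
  by rewrite /step_kernel zx zy => /eqP; rewrite (negbTE ww').
have mcell : measurable cell by exact: measurableX.
have : ((pi \x pi) cell <= (pi \x pi) N)%E by apply: le_measure; rewrite ?inE.
have mass0 p : (0 < pi (cls @^-1` [set p]))%E.
  by rewrite -(fineK (fin_num_measure pi _ (mcls p))) lte_fin; exact: mass_gt0.
by rewrite N0 product_measure1E // => /le_gtF; rewrite mule_gt0 ?mass0.
Qed.

End Trajectory.

Local Open Scope classical_set_scope.

Theorem mainTheorem4 (R : realType) (d : measure_display)
    (Omega : measurableType d) (pi : probability Omega R) :
  atomless pi -> separable_sigma_algebra pi ->
  exists (k : nat) (Q : graph k -> graph k -> R) (W : Omega * Omega -> R),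
    [/\ is_rule Q, graphon pi W &
        exists Phi : R -> Omega * Omega -> R,
          [/\ is_trajectory pi Q W Phi,
              forall t, 0 <= t -> graphon pi (Phi t),
              exists2 P : R, 0 < P &
                forall t, 0 <= t -> Phi (t + P) = Phi t %[ae (pi \x pi)%E] &
              exists2 t : R, 0 <= t & ~ (Phi t = W %[ae (pi \x pi)%E])]].
Proof.
move=> at_pi _; have [cls [mcls mass_gt0]] := atomless_partition at_pi.
(* The equation of the orbit carries the factor 8 s. *)
pose s := circulation_rate pi cls / 8%:R.
have s0 : 0 < s by rewrite divr_gt0 ?circulation_rate_gt0.
have sE : circulation_rate pi cls = 8%:R * s by rewrite mulrCA divff ?mulr1.
pose Phi t := step_kernel cls (block_value (orbit_u s t) (orbit_v s t)).
have gPhi t : graphon pi (Phi t).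
  by apply: graphon_step_kernel => //; [exact: orbit_u_itv|exact: orbit_v_itv].
exists 8, (circulation_rule pi cls), (Phi 0); split => //.
  exact: is_rule_circulation.
exists Phi; split => [|t _||].
- apply: (is_trajectory_block mcls (du := fun t => orbit_speed s t *
      (1 - 2 * orbit_v s t)) (dv := fun t => orbit_speed s t *
      (2 * orbit_u s t - 1)) (orbit_u_itv s) (orbit_v_itv s)) => [t|t|t z].
  + exact: is_derive_orbit_u.
  + exact: is_derive_orbit_v.
  + by rewrite velocity_circulation // sE.
- exact: gPhi.
(* Two half periods compose the antipodal map with itself, which is the identity. *)
- exists (orbit_half_period s *+ 2) => [|t _].
    by rewrite pmulrn_lgt0 // orbit_half_period_gt0.
  apply: aeW => z _; rewrite /Phi mulr2n addrA.
  by rewrite !orbit_u_half_period // !orbit_v_half_period // !subKr.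
- exists (orbit_half_period s); first exact/ltW/orbit_half_period_gt0.
  (* The block between these two parts carries u, which after half a period equals 1 - u(0). *)
  apply: (step_kernel_neq mcls mass_gt0 (x := (false, false)) (y := (false, true))).
  rewrite /block_value /= -[X in orbit_u s X]add0r orbit_u_half_period //.
  by rewrite eq_sym orbit_u0_neq.
Qed.
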